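(* Let $(H,\mu)$ be a Hilbertian algebra. Then $(H,\mu)$ is a Hilbertian $H^*$-algebra if, and only if, $(H,\mu)$ is a Hilbertian Frobenius semigroup.
   Context: All Hilbert spaces are complex; $\hat{\otimes}_2$ is the Hilbert space tensor product; $f^{\dagger}$ is the Hilbert adjoint of a bounded linear map $f$. A Hilbertian algebra is a pair $(H,\mu)$ with $H$ a Hilbert space and $\mu\colon H\hat{\otimes}_2H\to H$ a bounded linear map which is associative and commutative (no unit is assumed); write $xy:=\mu(x\otimes y)$. With $\alpha\colon (H\hat{\otimes}_2H)\hat{\otimes}_2H\to H\hat{\otimes}_2(H\hat{\otimes}_2H)$ the canonical unitary, $(H,\mu)$ is a Hilbertian Frobenius semigroup when $(\mu\hat{\otimes}_2 id)\circ\alpha^{-1}\circ(id\hat{\otimes}_2\mu^{\dagger})=\mu^{\dagger}\circ\mu=(id\hat{\otimes}_2\mu)\circ\alpha\circ(\mu^{\dagger}\hat{\otimes}_2 id)$. An $H^*$-adjoint of $u\in H$ is an element $v\in H$ such that $\langle uw,w'\rangle=\langle w,vw'\rangle$ for all $w,w'\in H$. $(H,\mu)$ is a Hilbertian $H^*$-algebra when every element of $H$ has an $H^*$-adjoint (not required to be unique). *)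

(* Defs.v *)
From HB Require Import structures.
From mathcomp Require Import all_boot all_order all_algebra.
From mathcomp Require Import all_classical all_reals all_analysis.
From mathcomp Require Export complex.
Set Implicit Arguments.
Unset Strict Implicit.
Unset Printing Implicit Defensive.
Import Order.TTheory GRing.Theory Num.Theory.
Import numFieldNormedType.Exports.
Local Open Scope classical_set_scope.
Local Open Scope ring_scope.

(* A Hilbert space over R[i], the complex numbers over an arbitrary realType R.
   The inner product is linear in its first argument and conjugate-linear in
   the second one, as for {dot _ for conjC}. *)
HB.mixin Record NormedModule_isHilbert (R : realType) H
    of NormedModule R[i] H := {
  hdot : {dot H for (@Num.conj R[i])} ;
  hdot_norm : forall x : H, `|x| ^+ 2 = hdot x x
}.

#[short(type="hilbertType")]
HB.structure Definition Hilbert (R : realType) :=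
  {H of CompleteNormedModule R[i] H & NormedModule_isHilbert R H}.

Notation "'[< u , v >]" := (hdot u v) : ring_scope.

Section BoundedMaps.
Context {R : realType}.
Implicit Types H K : hilbertType R.

Definition bounded_linear H K (f : H -> K) : Prop :=
  linear f /\ exists M : R[i], forall x, `|f x| <= M * `|x|.

Definition is_adjoint H K (f : H -> K) (g : K -> H) : Prop :=
  bounded_linear g /\ forall x y, '[< f x, y >] = '[< x, g y >].

(* The adjoint is the only g such that is_adjoint f g; it exists, by the Riesz
   representation theorem, as soon as f is bounded and linear. *)
Definition adjoint H K (f : H -> K) : K -> H := xget (fun=> 0) (is_adjoint f).

Definition unitary H K (f : H -> K) : Prop :=
  [/\ linear f, bijective f & forall x y, '[< f x, f y >] = '[< x, y >]].

Definition inverse H K (f : H -> K) : K -> H :=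
  xget (fun=> 0) [set g | cancel f g /\ cancel g f].

End BoundedMaps.

(* A Hilbert tensor product of H and K: a Hilbert space with a bilinear map
   (x, y) |-> x (x) y such that <x (x) y, x' (x) y'> = <x, x'> <y, y'> and the
   finite sums of elementary tensors are dense (these sums form a linear
   subspace, since scalars can be moved inside the tensors). These properties
   determine the Hilbert tensor product up to a unique unitary compatible with
   elementary tensors. *)
Record htensor (R : realType) (H K : hilbertType R) := HTensor {
  htensor_space :> hilbertType R ;
  pure : {bilinear H -> K -> htensor_space} ;
  pure_dot : forall x x' y y',
    '[< pure x y, pure x' y' >] = '[< x, x' >] * '[< y, y' >] ;
  pure_dense : dense [set z : htensor_space |
    exists s : seq (H * K), z = \sum_(p <- s) pure p.1 p.2]
}.
Arguments pure {R H K} h.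

Section TensorMaps.
Context {R : realType}.
Implicit Types H K L : hilbertType R.

(* f (x)_2 g, for bounded linear f and g: the only bounded linear map
   sending each x (x) y to f x (x) g y. *)
Definition tensor_map H K H' K' (T : htensor H K) (T' : htensor H' K')
    (f : H -> H') (g : K -> K') : T -> T' :=
  xget (fun=> 0) [set h : T -> T' | bounded_linear h /\
    forall x y, h (pure T x y) = pure T' (f x) (g y)].

(* The canonical unitary (H (x) K) (x) L -> H (x) (K (x) L), determined by its
   values on elementary tensors. *)
Definition associator H K L (HK : htensor H K) (KL : htensor K L)
    (HK_L : htensor HK L) (H_KL : htensor H KL) : HK_L -> H_KL :=
  xget (fun=> 0) [set a : HK_L -> H_KL | unitary a /\
    forall x y z, a (pure HK_L (pure HK x y) z) = pure H_KL x (pure KL y z)].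

End TensorMaps.
Arguments tensor_map {R H K H' K'} T T' f g.
Arguments associator {R H K L} HK KL HK_L H_KL.

Section HilbertianAlgebras.
Context {R : realType} {H : hilbertType R} {HH : htensor H H}.
Implicit Types mu : HH -> H.

Definition hmul mu (x y : H) : H := mu (pure HH x y).

Definition hilbertian_algebra mu : Prop :=
  [/\ bounded_linear mu, associative (hmul mu) & commutative (hmul mu)].

Definition Hstar_adjoint mu (u v : H) : Prop :=
  forall w w', '[< hmul mu u w, w' >] = '[< w, hmul mu v w' >].

Definition hilbertian_Hstar_algebra mu : Prop :=
  hilbertian_algebra mu /\ forall u, exists v, Hstar_adjoint mu u v.

Definition hilbertian_frobenius_semigroup
    (HH_H : htensor HH H) (H_HH : htensor H HH) mu : Prop :=
  let alpha := associator HH HH HH_H H_HH in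
  let mu' := adjoint mu in
  [/\ hilbertian_algebra mu,
      tensor_map HH_H HH mu idfun \o inverse alpha \o tensor_map HH H_HH idfun mu'
        = mu' \o mu
    & mu' \o mu
        = tensor_map H_HH HH idfun mu \o alpha \o tensor_map HH HH_H mu' idfun].

End HilbertianAlgebras.

(* Main.v *)
Require Import Defs.
From mathcomp Require Import all_boot all_order all_algebra.
From mathcomp Require Import all_classical all_reals all_analysis.
From mathcomp Require Import ring lra.
Set Implicit Arguments.
Unset Strict Implicit.
Unset Printing Implicit Defensive.
Import Order.TTheory GRing.Theory Num.Theory.
Import numFieldNormedType.Exports.
Local Open Scope classical_set_scope.
Local Open Scope ring_scope.

(** Write [L_y] for the multiplication by [y] and [L_y^+] for its Hilbert
    adjoint, which exists by the Riesz representation theorem. The argument has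
    two halves.

    First, both sides of the Frobenius equations are bounded maps, so that the
    equations amount to equalities between matrix coefficients at elementary
    tensors. Since the three maps are built from [mu], its adjoint and
    identities, these coefficients can be computed, and the equations become
    [<xy, ab> = <x, a (L_y^+ b)>] and [<xy, ab> = <y, (L_x^+ a) b>]
    ([frobenius_pointwise]). This requires [tensor_map] and [associator], which
    are defined by choice, to exist: the first is the continuous extension of
    its values on finite sums of elementary tensors, bounded there by Schur's
    theorem on products of positive kernels ([schur_ge0]); the second comes
    from two total families with the same Gram matrix ([total_unitary]).

    Second, by commutativity each equation says that every [L_y^+] is a module
    map, [L_y^+ (ab) = a (L_y^+ b)]. If [v] is an [H^*]-adjoint of [y] then
    [L_y^+ = L_v] and this is associativity. The converse must produce an
    element [v] with [L_y^+ = L_v], although there is no unit at which to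
    evaluate [L_y^+]. The module law gives [L_c = L_y^+ L_b] for
    [c = L_y^+ b], hence [L_c^+ = L_b^+ L_y] is again a multiplication: all
    the elements [L_y^+ b] have [H^*]-adjoints ([Hstar_adjoint_hmul]), and so
    do their products. These products lie in the domain [P] of a linear relation
    contained in the graph of the passage to the adjoint and isometric
    ([star_graph]), which makes [P] a closed subspace. An element orthogonal to
    all these products annihilates
    the algebra ([orthogonal_products_annihilator]). Hence every element [u] is
    the sum of an element [c] of [P] and of an annihilating element, and the
    [H^*]-adjoint of [c] is one of [u]. *)

(** * Inner products and norms *)

Section InnerProduct.
Context {R : realType} {H : hilbertType R}.
Implicit Types (x y z : H) (a : R[i]) (e : R).

Lemma hdotC x y : '[< x, y >] = ('[< y, x >])^*.
Proof. by rewrite (hermC hdot) expr0 mul1r. Qed.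

Lemma hdotDl x y z : '[< x + y, z >] = '[< x, z >] + '[< y, z >].
Proof. exact: linearDl. Qed.

Lemma hdotDr x y z : '[< z, x + y >] = '[< z, x >] + '[< z, y >].
Proof. exact: linearDr. Qed.

Lemma hdotBl x y z : '[< x - y, z >] = '[< x, z >] - '[< y, z >].
Proof. exact: linearBl. Qed.

Lemma hdotBr x y z : '[< z, x - y >] = '[< z, x >] - '[< z, y >].
Proof. exact: linearBr. Qed.

Lemma hdot0l x : '[< 0, x >] = 0. Proof. exact: linear0l. Qed.
Lemma hdot0r x : '[< x, 0 >] = 0. Proof. exact: linear0r. Qed.

Lemma hdotZl a x y : '[< a *: x, y >] = a * '[< x, y >].
Proof. exact: linearZl_LR. Qed.

Lemma hdotZr a x y : '[< x, a *: y >] = a^* * '[< x, y >].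
Proof. exact: linearZr_LR. Qed.

Lemma hdot_suml (I : Type) (r : seq I) (F : I -> H) y :
  '[< \sum_(i <- r) F i, y >] = \sum_(i <- r) '[< F i, y >].
Proof.
by elim: r => [|i r IH]; rewrite ?big_nil ?hdot0l // !big_cons hdotDl IH.
Qed.

Lemma hdot_sumr (I : Type) (r : seq I) (F : I -> H) x :
  '[< x, \sum_(i <- r) F i >] = \sum_(i <- r) '[< x, F i >].
Proof.
by elim: r => [|i r IH]; rewrite ?big_nil ?hdot0r // !big_cons hdotDr IH.
Qed.

Lemma hdot_eq0 x : '[< x, x >] = 0 -> x = 0.
Proof. by move/eqP; rewrite dnorm_eq0 => /eqP. Qed.

Lemma hdot_inj x y : (forall z, '[< z, x >] = '[< z, y >]) -> x = y.
Proof.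
by move=> xy; apply/subr0_eq/hdot_eq0; rewrite hdotBr xy subrr.
Qed.

(** Expand the square norm of [<y, y> x - <x, y> y]. *)
Lemma cauchy_schwarz x y : `| '[< x, y >] | <= `|x| * `|y|.
Proof.
rewrite -(@ler_pXn2r _ 2) ?nnegrE ?mulr_ge0 // exprMn !hdot_norm.
have [->|y0] := eqVneq y 0; first by rewrite !hdot0r normr0 expr0n mulr0.
have yy0 : 0 < '[< y, y >] by rewrite dnorm_gt0.
have := dnorm_ge0 hdot ('[< y, y >] *: x - '[< x, y >] *: y).
rewrite hdotBl !hdotBr !hdotZl !hdotZr (hdotC y x) normCK.
have -> : ('[< y, y >])^* = '[< y, y >] by rewrite -hdotC.
set b := '[< x, y >]; set c := '[< y, y >]; set d := '[< x, x >] => h.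
rewrite -subr_ge0 -(pmulr_rge0 _ yy0) -/c; apply: le_trans h _.
by rewrite le_eqVlt; apply/orP; left; apply/eqP; ring.
Qed.

(** The norm of the space takes values in the complex numbers, whose order is
    only partial; infima and comparisons are made on this real version. *)
Definition nrm x : R := complex.Re `|x|.

Lemma nrmE x : `|x| = (nrm x)%:C%C.
Proof. by rewrite /nrm RRe_real // normr_real. Qed.

Lemma nrm_ge0 x : 0 <= nrm x.
Proof. by rewrite -ler0c -nrmE. Qed.

Lemma ler_nrmD x y : nrm (x + y) <= nrm x + nrm y.
Proof. by rewrite -lecR rmorphD /= -!nrmE ler_normD. Qed.

Lemma nrmC x y : nrm (x - y) = nrm (y - x).
Proof. by rewrite /nrm distrC. Qed.

Lemma nrm_eq0 x : nrm x <= 0 -> x = 0.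
Proof. by rewrite -lecR -nrmE normr_le0 => /eqP. Qed.

Lemma nrm0 : nrm 0 = 0. Proof. by rewrite /nrm normr0. Qed.

Lemma nrm_dot x : '[< x, x >] = (nrm x ^+ 2)%:C%C.
Proof. by rewrite -hdot_norm nrmE rmorphXn. Qed.

Lemma nrm_cauchy_schwarz x y : complex.Re `| '[< x, y >] | <= nrm x * nrm y.
Proof. by rewrite -lecR rmorphM /= RRe_real ?normr_real// -!nrmE cauchy_schwarz. Qed.

Lemma parallelogram x y :
  nrm (x + y) ^+ 2 + nrm (x - y) ^+ 2 = 2 * nrm x ^+ 2 + 2 * nrm y ^+ 2.
Proof.
have : '[< x + y, x + y >] + '[< x - y, x - y >] =
    2%:R * '[< x, x >] + 2%:R * '[< y, y >].
  by rewrite !hdotBl !hdotBr !hdotDl !hdotDr; ring.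
rewrite !nrm_dot -(rmorph_nat (@real_complex R)) -!rmorphM -!rmorphD /=.
exact: complexI.
Qed.

Lemma closure_nrmP (S : set H) x : closure S x <->
  forall e, 0 < e -> exists2 y, S y & nrm (x - y) < e.
Proof.
split=> [Sx e e0|Sx B /nbhs_ballP[e/= e0 eB]].
  have /Sx[y [Sy]] : nbhs x (ball x e%:C%C).
    by apply: nbhsx_ballx; rewrite ltcE /= eqxx.
  by rewrite -ball_normE /= nrmE ltcR; exists y.
have [|y Sy xy] := Sx (complex.Re e); first by move: e0; rewrite ltcE /= => /andP[].
exists y; split => //; apply: eB; rewrite -ball_normE /= nrmE.
by rewrite -(RRe_real (gtr0_real e0)) ltcR.
Qed.

End InnerProduct.

(** * Limits of bounded relations *)

Section Completeness.
Context {R : realType}.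
Implicit Types X Y H : hilbertType R.

Lemma closure_pair_nrmP X Y (G : set (X * Y)) x y : closure G (x, y) <->
  forall e : R, 0 < e ->
    exists x' y', [/\ G (x', y'), nrm (x - x') < e & nrm (y - y') < e].
Proof.
split=> [Gxy e e0|Gxy B /nbhs_ballP[e/= e0 eB]].
  have /Gxy[[x' y'] [Gxy' []]] : nbhs (x, y) (ball (x, y) e%:C%C).
    by apply: nbhsx_ballx; rewrite ltcE /= eqxx.
  by rewrite -!ball_normE /= !nrmE !ltcR; exists x', y'.
have [|x' [y' [Gxy' xx' yy']]] := Gxy (complex.Re e).
  by move: e0; rewrite ltcE /= => /andP[].
exists (x', y'); split => //; apply: eB.
by split; rewrite -ball_normE /= nrmE -(RRe_real (gtr0_real e0)) ltcR.
Qed.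

(** The vectors [y'] related to approximations [x'] of [x] generate a Cauchy
    filter, by the bound applied to differences; its limit is the required
    [y]. *)
Lemma bounded_relation_closure X Y (G : set (X * Y)) (M : R) x :
    (forall p q, G p -> G q -> G (p - q)) ->
    (forall p, G p -> nrm p.2 <= M * nrm p.1) ->
  closure (fst @` G) x -> exists y, closure G (x, y).
Proof.
move=> GB GM /closure_nrmP Gx.
pose F : set_system Y := [set A | exists2 e : R, 0 < e &
  forall p, G p -> nrm (x - p.1) < e -> A p.2].
have FF : ProperFilter F.
  split=> [[e e0 eF]|].
    by have [_ [p Gp <-] xp] := Gx _ e0; exact: eF Gp xp.
  split=> [|A B [e e0 eA] [d d0 dB]|A B AB [e e0 eA]].
  - by exists 1.
  - exists (Num.min e d); first by rewrite lt_min e0.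
    by move=> p Gp; rewrite lt_min => /andP[? ?]; split; [apply: eA|apply: dB].
  - by exists e => // p Gp xp; apply: AB; apply: eA.
have : cauchy F.
  apply/cauchy_ballP => e e0.
  pose c := complex.Re e / (2 * (`|M| + 1)).
  have e'0 : 0 < complex.Re e by move: e0; rewrite ltcE /= => /andP[].
  have M1 : 0 < `|M| + 1 by rewrite ltr_wpDl.
  have c0 : 0 < c by rewrite divr_gt0 ?mulr_gt0.
  pose A := [set y | exists2 p, G p /\ nrm (x - p.1) < c & p.2 = y].
  have FA : F A by exists c => // p Gp xp; exists p.
  exists (A, A) => //= -[_ _] [/= [p [Gp xp] <-] [q [Gq xq] <-]].
  rewrite -ball_normE /= nrmE -(RRe_real (gtr0_real e0)) ltcR.
  apply: le_lt_trans (GM _ (GB _ _ Gp Gq)) _ => /=.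
  have pq : nrm (p.1 - q.1) < 2 * c.
    have -> : p.1 - q.1 = (p.1 - x) + (x - q.1) by rewrite addrA subrK.
    by apply: le_lt_trans (ler_nrmD _ _) _; rewrite nrmC mulr_natl mulr2n ltrD.
  have -> : complex.Re e = (`|M| + 1) * (2 * c).
    by rewrite /c; field; rewrite gt_eqF.
  have := nrm_ge0 (p.1 - q.1); have := ler_norm M; have := normr_ge0 M.
  by nra.
move=> /cauchy_cvgP/cvg_ex[y /fcvg_ballP Fy]; exists y.
apply/closure_pair_nrmP => e e0.
have [|d d0 dF] := Fy e%:C%C; first by rewrite ltcE /= eqxx.
have [|_ [[x' y'] Gp <-]] := Gx (Num.min e d); first by rewrite lt_min e0.
rewrite lt_min => /andP[xe xd]; exists x', y'; split => //.
by have := dF _ Gp xd; rewrite -ball_normE /= nrmE ltcR.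
Qed.

End Completeness.

Lemma closed_dot_eq (R : realType) (X : hilbertType R) (s t : X) :
  closed [set c : X * X | '[< c.1, s >] = '[< t, c.2 >]].
Proof.
move=> [c c'] /closure_pair_nrmP Gc /=; apply/subr0_eq/eqP.
rewrite -normr_le0 -(RRe_real (normr_real _)) -[0]/(0%:C%C) lecR.
have C0 : 0 < nrm s + nrm t + 1 by rewrite ltr_wpDl ?addr_ge0 ?nrm_ge0.
apply/ler_addgt0Pr => e e0; rewrite add0r.
have [|d [d' [/= dd cd cd']]] := Gc (e / (nrm s + nrm t + 1)).
  exact: divr_gt0.
have -> : '[< c, s >] - '[< t, c' >] = '[< c - d, s >] - '[< t, c' - d' >].
  by rewrite hdotBl hdotBr dd; ring.
have eE : e = (nrm s + nrm t + 1) * (e / (nrm s + nrm t + 1)).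
  by rewrite mulrC mulfVK ?gt_eqF.
have h1 := nrm_cauchy_schwarz (c - d) s.
have h2 := nrm_cauchy_schwarz t (c' - d').
have : complex.Re `|'[< c - d, s >] - '[< t, c' - d' >]| <=
    complex.Re `|'[< c - d, s >]| + complex.Re `|'[< t, c' - d' >]|.
  rewrite -lecR [leRHS]rmorphD !RRe_real ?normr_real//.
  exact: ler_normB.
move/le_trans; apply; rewrite eE.
have := ler_wpM2r (nrm_ge0 s) (ltW cd).
have := ler_wpM2l (nrm_ge0 t) (ltW cd').
have := ltW (divr_gt0 e0 C0); clear eE; move: h1 h2.
set q := e / _; set a := complex.Re _; set b := complex.Re _.
by rewrite !mulrDl mul1r [nrm s * q]mulrC; lra.
Qed.

Lemma closure_submodule (R : realType) (V : normedModType R[i]) (S : set V) :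
    (forall a u v, S u -> S v -> S (a *: u + v)) ->
  forall a u v, closure S u -> closure S v -> closure S (a *: u + v).
Proof.
move=> SP a u v Su Sv B Bauv.
have cont : (fun p : V * V => a *: p.1 + p.2) @ (u, v) --> a *: u + v.
  apply: cvgD; last exact: cvg_snd.
  by apply: cvgZr; exact: cvg_fst.
have [/= [A1 A2] [/= uA1 vA2] AB] := cont _ Bauv.
have [u' [Su' Au']] := Su _ uA1; have [v' [Sv' Av']] := Sv _ vA2.
exists (a *: u' + v'); split; first exact: SP.
exact: (AB (u', v')).
Qed.

(** * Orthogonal projections and adjoints *)

Section Projection.
Context {R : realType}.
Implicit Types X Y H : hilbertType R.

(** Among the multiples of [s], the best approximation of [z] is
    [<z, s> / <s, s>]; it lies at square distance
    [<z, z> - |<z, s>| ^ 2 / <s, s>] from [z]. *)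
Lemma minimal_orthogonal H (z s : H) :
  (forall a, nrm z <= nrm (z - a *: s)) -> '[< s, z >] = 0.
Proof.
move=> zmin; have [->|s0] := eqVneq s 0; first exact: hdot0l.
have n0 : 0 < '[< s, s >] by rewrite dnorm_gt0.
pose a := '[< z, s >] / '[< s, s >].
have : '[< z, z >] <= '[< z - a *: s, z - a *: s >].
  by rewrite !nrm_dot lecR ler_pXn2r ?nnegrE ?nrm_ge0.
rewrite hdotBl !hdotBr !hdotZl !hdotZr (hdotC s z) /a.
rewrite rmorphM fmorphV /= -(hdotC s s).
set h := '[< z, s >]; set n := '[< s, s >].
rewrite -subr_ge0 => h0; have {h0} : 0 <= - (h * h^*) / n.
  apply: le_trans h0 _; rewrite le_eqVlt; apply/orP; left; apply/eqP.
  by field; rewrite gt_eqF.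
rewrite pmulr_lge0 ?invr_gt0// oppr_ge0 -normCK => h0.
have : `|h| ^+ 2 == 0 by rewrite eq_le h0 exprn_ge0.
by rewrite sqrf_eq0 normr_eq0 => /eqP ->; rewrite conjC0.
Qed.

(** A minimizing sequence is Cauchy by the parallelogram law, as the midpoint
    of two near-minimizers is no closer than the infimum [d]. *)
Lemma orthogonal_projection H (S : set H) x :
    S 0 -> (forall a u v, S u -> S v -> S (a *: u + v)) -> closed S ->
  exists2 p, S p & forall s, S s -> '[< s, x - p >] = 0.
Proof.
move=> S0 SP Scl.
pose E := [set nrm (x - s) | s in S]; pose d := inf E.
have Einf : has_inf E.
  split; first by exists (nrm (x - 0)); exists 0.
  by exists 0 => _ [s _ <-]; exact: nrm_ge0.
have dE s : S s -> d <= nrm (x - s).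
  by move=> Ss; apply: ge_inf; [case: Einf|exists s].
have d0 : 0 <= d.
  by apply: lb_le_inf => [|_ [s _ <-]]; [case: Einf|exact: nrm_ge0].
have near e : 0 < e -> exists2 s, S s & nrm (x - s) < d + e.
  by move=> e0; have [_ [s Ss <-]] := inf_adherent e0 Einf; exists s.
pose F : set_system H := [set A | exists2 e : R, 0 < e &
  forall s, S s -> nrm (x - s) < d + e -> A s].
have FF : ProperFilter F.
  split=> [[e e0 eF]|].
    by have [s Ss xs] := near _ e0; exact: eF Ss xs.
  split=> [|A B [e e0 eA] [c c0 cB]|A B AB [e e0 eA]].
  - by exists 1.
  - exists (Num.min e c); first by rewrite lt_min e0.
    move=> s Ss; rewrite -ltrBlDl lt_min !ltrBlDl => /andP[? ?].
    by split; [apply: eA|apply: cB].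
  - by exists e => // s Ss xs; apply: AB; apply: eA.
have : cauchy F.
  apply/cauchy_ballP => e e0.
  have e'0 : 0 < complex.Re e by move: e0; rewrite ltcE /= => /andP[].
  set e' := complex.Re e in e'0.
  (* this choice gives 8 * d * c + 4 * c ^ 2 < e' ^ 2 *)
  pose c := e' ^+ 2 / (8 * d + 4 + e' ^+ 2).
  have D0 : 0 < 8 * d + 4 + e' ^+ 2 by nra.
  have c0 : 0 < c by rewrite divr_gt0 ?exprn_gt0.
  have cD : c * (8 * d + 4 + e' ^+ 2) = e' ^+ 2.
    by rewrite /c mulfVK // gt_eqF.
  pose A := [set s | S s /\ nrm (x - s) < d + c].
  have FA : F A by exists c.
  exists (A, A) => //= -[s t] [/= [Ss xs] [St xt]].
  rewrite -ball_normE /= nrmE -(RRe_real (gtr0_real e0)) ltcR -/e'.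
  have dst : 2 * d <= nrm ((x - t) + (x - s)).
    have h2 : (2^-1 : R[i]) *: (t + s) = (2^-1) *: t + ((2^-1) *: s + 0).
      by rewrite addr0 scalerDr.
    have /dE : S ((2^-1 : R[i]) *: (t + s)).
      by rewrite h2; do 2 apply: (SP) => //.
    have -> : x - t + (x - s) = (2 : R[i]) *: (x - 2^-1 *: (t + s)).
      rewrite scalerBr scalerA divff ?pnatr_eq0// scale1r scaler_nat mulr2n.
      by rewrite opprD addrACA.
    rewrite -!lecR rmorphM /= -!nrmE normrZ normr_nat rmorph_nat => ?.
    by rewrite ler_pM2l ?ltr0n.
  have := parallelogram (x - t) (x - s).
  have -> : x - t - (x - s) = s - t.
    by rewrite opprB addrC addrA subrK.
  have := nrm_ge0 (x - s); have := nrm_ge0 (x - t); have := nrm_ge0 (s - t).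
  set st := nrm (s - t); move: xs xt dst.
  set a := nrm (x - s); set b := nrm (x - t); set m := nrm (x - t + (x - s)).
  move=> ac bc dm st0 b0 a0 par.
  rewrite -(@ltr_pXn2r _ 2) ?nnegrE//; last exact: ltW.
  clearbody c e' d m a b st.
  have m4 : 4 * d ^+ 2 <= m ^+ 2 by nra.
  have a2 : a ^+ 2 < (d + c) ^+ 2 by nra.
  have b2 : b ^+ 2 < (d + c) ^+ 2 by nra.
  have c1 : c < 1 by nra.
  by nra.
move=> /cauchy_cvgP/cvg_ex[p /fcvg_ballP Fp].
have approx e : 0 < e -> exists2 s, S s & nrm (p - s) < e /\ nrm (x - s) < d + e.
  move=> e0; have [|c c0 cF] := Fp e%:C%C; first by rewrite ltcE /= eqxx.
  have [|s Ss] := near (Num.min e c); first by rewrite lt_min e0.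
  rewrite -ltrBlDl lt_min !ltrBlDl => /andP[xe xc]; exists s => //; split => //.
  by have := cF _ Ss xc; rewrite -ball_normE /= nrmE ltcR.
have Sp : S p.
  by apply/Scl/closure_nrmP => e /approx[s Ss [ps _]]; exists s.
have pd : nrm (x - p) <= d.
  apply/ler_addgt0Pr => e e0; have [|s Ss [ps xs]] := approx (e / 2).
    by rewrite divr_gt0.
  have -> : x - p = (x - s) + (s - p) by rewrite addrA subrK.
  by apply: le_trans (ler_nrmD _ _) _; rewrite (nrmC s); lra.
exists p => // s Ss; apply: minimal_orthogonal => a.
by apply: le_trans pd _; rewrite -addrA -opprD (addrC p); apply: dE; apply: SP.
Qed.

(** A vector [z] orthogonal to the kernel of a nonzero functional [phi]
    represents it up to a scalar: [phi x *: z - phi z *: x] is in the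
    kernel. *)
Theorem riesz_representation H (phi : H -> R[i]) (M : R) :
    (forall a x y, phi (a *: x + y) = a * phi x + phi y) ->
    (forall x, complex.Re `|phi x| <= M * nrm x) ->
  exists y, forall x, phi x = '[< x, y >].
Proof.
move=> phiP phiM.
have phi0 : phi 0 = 0.
  by have := phiP 1 0 0; rewrite scaler0 addr0 mul1r -[LHS]addr0 => /addrI.
have phiZ a x : phi (a *: x) = a * phi x by rewrite -[a *: x]addr0 phiP phi0 addr0.
have phiB x y : phi (x - y) = phi x - phi y.
  by rewrite addrC -scaleN1r phiP mulN1r addrC.
have [phi_eq0|] := pselect (forall x, phi x = 0).
  by exists 0 => x; rewrite phi_eq0 hdot0r.
move=> /existsNP[x0 /eqP phix0].
have [|a u v /= u0 v0||p p0 pS] := @orthogonal_projection H [set x | phi x = 0] x0.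
- exact: phi0.
- by rewrite phiP u0 v0 mulr0 addr0.
- move=> x /closure_nrmP xS /=; apply/eqP; rewrite -normr_le0.
  rewrite -(RRe_real (normr_real (phi x))) -[0]/(0%:C%C) lecR.
  apply/ler_addgt0Pr => e e0; rewrite add0r.
  have M1 : 0 < `|M| + 1 by rewrite ltr_wpDl.
  have [|s s0 xs] := xS (e / (`|M| + 1)); first by rewrite divr_gt0.
  rewrite -[phi x]subr0 -[X in _ - X]s0 -phiB; apply: le_trans (phiM _) _.
  have -> : e = (`|M| + 1) * (e / (`|M| + 1)) by rewrite mulrC mulfVK ?gt_eqF.
  by have := nrm_ge0 (x - s); have := ler_norm M; nra.
set z := x0 - p in pS.
have phiz : phi z = phi x0 by rewrite phiB p0 subr0.
have z0 : '[< z, z >] != 0.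
  apply/eqP => /hdot_eq0 z0; move: phix0; rewrite -phiz z0 phi0 eqxx //.
exists ((phi z / '[< z, z >])^* *: z) => x.
have := pS (phi x *: z - phi z *: x).
rewrite /= phiB !phiZ mulrC subrr => /(_ erefl).
rewrite hdotBl !hdotZl hdotZr conjCK => /subr0_eq h.
by rewrite mulrAC -h mulfK.
Qed.

Lemma bounded_linear_nrm X Y (f : X -> Y) : bounded_linear f ->
  exists2 M : R, 0 <= M & forall x, nrm (f x) <= M * nrm x.
Proof.
case=> _ [M fM]; exists (complex.Re `|M|).
  by rewrite -ler0c RRe_real ?normr_real.
move=> x; rewrite -lecR rmorphM /= RRe_real ?normr_real// -!nrmE.
apply: le_trans (fM x) _; have h : 0 <= M * `|x| by apply: le_trans (fM x).
by rewrite -(ger0_norm h) normrM normr_id.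
Qed.

Lemma nrm_bounded_linear X Y (f : X -> Y) (M : R) : linear f ->
  (forall x, nrm (f x) <= M * nrm x) -> bounded_linear f.
Proof.
move=> fL fM; split => //; exists M%:C%C => x.
by rewrite !nrmE -rmorphM lecR.
Qed.

Lemma adjoint_exists X Y (f : X -> Y) :
  bounded_linear f -> exists g, is_adjoint f g.
Proof.
move=> fb; have [M M0 fM] := bounded_linear_nrm fb; have [fL _] := fb.
have /choice[g fg] : forall y, exists z, forall x, '[< f x, y >] = '[< x, z >].
  move=> y; apply: (riesz_representation (M := M * nrm y)) => [a u v|x].
    by rewrite fL hdotDl hdotZl.
  apply: le_trans (nrm_cauchy_schwarz _ _) _.
  by rewrite mulrAC ler_wpM2r ?nrm_ge0.
exists g; split; last by move=> x y; exact: fg.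
have gL : linear g.
  move=> a u v; apply: hdot_inj => x.
  by rewrite -fg !hdotDr !hdotZr !fg.
apply: (nrm_bounded_linear (M := M)) => // y.
have [->|gy0] := eqVneq (nrm (g y)) 0; first by rewrite mulr_ge0 ?nrm_ge0.
have gy : 0 < nrm (g y) by rewrite lt_neqAle eq_sym gy0 nrm_ge0.
rewrite -(ler_pM2r gy) -expr2.
have := nrm_cauchy_schwarz (f (g y)) y.
rewrite fg nrm_dot ger0_norm ?ler0c ?exprn_ge0 ?nrm_ge0//= => h.
by apply: le_trans h _; rewrite mulrAC ler_wpM2r ?nrm_ge0.
Qed.

Lemma adjointP X Y (f : X -> Y) :
  bounded_linear f -> is_adjoint f (adjoint f).
Proof. by move=> /adjoint_exists; exact: xgetPex. Qed.

End Projection.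

(** * Total families *)

Section Families.
Context {R : realType}.
Implicit Types X Y Z : hilbertType R.

Lemma bounded_linear_id X : bounded_linear (@idfun X).
Proof. by apply: (nrm_bounded_linear (M := 1)) => // x; rewrite mul1r. Qed.

Lemma bounded_linear_comp X Y Z (g : Y -> Z) (f : X -> Y) :
  bounded_linear g -> bounded_linear f -> bounded_linear (g \o f).
Proof.
move=> gb fb; have [N N0 gN] := bounded_linear_nrm gb.
have [M M0 fM] := bounded_linear_nrm fb.
apply: (nrm_bounded_linear (M := N * M)) => [a x y|x] /=.
  by rewrite fb.1 gb.1.
by apply: le_trans (gN _) _; rewrite -mulrA ler_wpM2l.
Qed.

Definition total_family X (I : Type) (u : I -> X) : Prop :=
  forall z, (forall i, '[< u i, z >] = 0) -> z = 0.

Lemma total_dot_inj X (I : Type) (u : I -> X) (z z' : X) : total_family u ->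
  (forall i, '[< u i, z >] = '[< u i, z' >]) -> z = z'.
Proof.
by move=> ut uz; apply/subr0_eq/ut => i; rewrite hdotBr uz subrr.
Qed.

(** For every [y], the two adjoints of [f] and [g] take at [y] values with the
    same inner products against the family. *)
Lemma total_bounded_linear_eq X Y (I : Type) (u : I -> X) (f g : X -> Y) :
    total_family u -> bounded_linear f -> bounded_linear g ->
  (forall i, f (u i) = g (u i)) -> f = g.
Proof.
move=> ut /adjointP[_ fa] /adjointP[_ ga] fg; apply/funext => x.
apply: hdot_inj => y; rewrite hdotC fa [RHS]hdotC ga.
congr (_^*); congr (hdot _ _); apply: (total_dot_inj ut) => i.
by rewrite -fa -ga fg.
Qed.

Lemma total_bounded_linear_id X (I : Type) (u : I -> X) (f : X -> X) :
    total_family u -> bounded_linear f -> (forall i, f (u i) = u i) ->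
  forall x, f x = x.
Proof.
move=> ut fb fu x.
by rewrite (total_bounded_linear_eq ut fb (bounded_linear_id X) fu).
Qed.

(** Subtract from [x] its projection onto the closed span of the family. *)
Lemma total_dense X (I : Type) (u : I -> X) (x : X) : total_family u ->
  closure [set x | exists s : seq (R[i] * I),
    x = \sum_(p <- s) p.1 *: u p.2] x.
Proof.
move=> ut; set S := [set x | _].
have SP a (y z : X) : S y -> S z -> S (a *: y + z).
  move=> [s ->] [t ->]; exists ([seq (a * p.1, p.2) | p <- s] ++ t).
  rewrite big_cat big_map scaler_sumr; congr (_ + _).
  by apply: eq_bigr => p _; rewrite scalerA.
have [|||p Sp pS] := @orthogonal_projection R X (closure S) x.
- by apply: subset_closure; exists [::]; rewrite big_nil.
- exact: closure_submodule.
- exact: closed_closure.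
suff -> : x = p by [].
apply/subr0_eq/ut => i; apply/pS/subset_closure.
by exists [:: (1, i)]; rewrite big_seq1 scale1r.
Qed.

(** The linear relation spanned by the pairs [(u i, v i)] is bounded, hence so
    is its closure, which is then the graph of the required map. *)
Theorem bounded_extension X Y (I : Type) (u : I -> X) (v : I -> Y) (M : R) :
    0 <= M -> total_family u ->
    (forall s : seq (R[i] * I), nrm (\sum_(p <- s) p.1 *: v p.2) <=
       M * nrm (\sum_(p <- s) p.1 *: u p.2)) ->
  exists2 h : X -> Y, bounded_linear h & forall i, h (u i) = v i.
Proof.
move=> M0 ut uv.
pose G : set (X * Y) := [set q | exists s : seq (R[i] * I),
  q = (\sum_(p <- s) p.1 *: u p.2, \sum_(p <- s) p.1 *: v p.2)].
have GP a (p q : X * Y) : G p -> G q -> G (a *: p + q).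
  move=> [s ->] [t ->]; exists ([seq (a * p.1, p.2) | p <- s] ++ t).
  apply: injective_projections; rewrite /= big_cat big_map scaler_sumr;
    by congr (_ + _); apply: eq_bigr => r _; rewrite scalerA.
have GM p : G p -> nrm p.2 <= M * nrm p.1 by move=> [s ->]; exact: uv.
have clGM x y : closure G (x, y) -> nrm y <= M * nrm x.
  move=> /closure_pair_nrmP Gxy; apply/ler_addgt0Pr => e e0.
  have M1 : 0 < M + 1 by rewrite ltr_wpDl.
  have [|x' [y' [/GM/= xy' xx' yy']]] := Gxy (e / (M + 1)); first exact: divr_gt0.
  have := ler_nrmD (y - y') y'; have := ler_nrmD (x' - x) x.
  rewrite !subrK (nrmC x').
  have -> : e = (M + 1) * (e / (M + 1)) by rewrite mulrC mulfVK ?gt_eqF.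
  by nra.
have clGP := closure_submodule GP.
have /choice[h Gh] : forall x, exists y, closure G (x, y).
  move=> x; apply: (bounded_relation_closure _ GM).
    by move=> p q Gp Gq; rewrite addrC -scaleN1r; apply: GP.
  apply: (closureS _ (total_dense ut)) => _ [s ->].
  by exists (\sum_(p <- s) p.1 *: u p.2, \sum_(p <- s) p.1 *: v p.2) => //; exists s.
have uniq x y : closure G (x, y) -> h x = y.
  move=> Gxy; apply/subr0_eq/nrm_eq0.
  have /clGM : closure G (-1 *: (x, y) + (x, h x)) by apply: clGP.
  by rewrite /= !scaleN1r !(addrC (- _)) subrr nrm0 mulr0.
exists h => [|i].
  apply: (nrm_bounded_linear (M := M)) => [a x y|x]; last exact: clGM.
  by apply: uniq; apply: (clGP a (x, h x) (y, h y)).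
apply/uniq/subset_closure; exists [:: (1, i)].
by rewrite !big_seq1 !scale1r.
Qed.

(** A common Gram matrix makes linear combinations of [u] and [v] with the same
    coefficients have the same norm. So the assignments [u i |-> v i] and
    [v i |-> u i] extend to bounded maps, inverse to each other. The adjoint of
    [h] composed with [h] fixes [u], again by equality of the Gram matrices,
    hence is the identity. *)
Theorem total_unitary X Y (I : Type) (u : I -> X) (v : I -> Y) :
    total_family u -> total_family v ->
    (forall i j, '[< v i, v j >] = '[< u i, u j >]) ->
  exists2 h : X -> Y, unitary h & forall i, h (u i) = v i.
Proof.
move=> ut vt uv.
have uvs (s : seq (R[i] * I)) :
    nrm (\sum_(p <- s) p.1 *: v p.2) = nrm (\sum_(p <- s) p.1 *: u p.2).
  apply/eqP; rewrite -(@eqrXn2 _ 2) ?nrm_ge0//; apply/eqP/(@complexI R).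
  rewrite -!nrm_dot !hdot_suml; apply: eq_bigr => p _.
  rewrite !hdot_sumr; apply: eq_bigr => q _.
  by rewrite !hdotZl !hdotZr uv.
have [h hb hu] : exists2 h : X -> Y, bounded_linear h & forall i, h (u i) = v i.
  by apply: (bounded_extension (M := 1)) => // s; rewrite mul1r uvs.
have [k kb kv] : exists2 k : Y -> X, bounded_linear k & forall i, k (v i) = u i.
  by apply: (bounded_extension (M := 1)) => // s; rewrite mul1r uvs.
exists h => //; split; first by case: hb.
  exists k => x.
    by apply: (total_bounded_linear_id ut (bounded_linear_comp kb hb)) => i /=;
      rewrite hu kv.
  by apply: (total_bounded_linear_id vt (bounded_linear_comp hb kb)) => i /=;
    rewrite kv hu.
move=> x y; have [hb' ha] := adjointP hb; rewrite ha; congr (hdot _ _).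
apply: (total_bounded_linear_id ut (bounded_linear_comp hb' hb)) => j /=.
by apply: (total_dot_inj ut) => i; rewrite -ha !hu uv.
Qed.

End Families.

(** * Products of positive kernels *)

Section GramKernel.
Context {R : realType}.
Implicit Types H K : hilbertType R.

(** The square norm of the finite sum of elementary tensors
    [\sum_(p <- s) p.1 (x) p.2], as a function of the list of factors. *)
Definition gram H K (s : seq (H * K)) : R[i] :=
  \sum_(p <- s) \sum_(q <- s) '[< p.1, q.1 >] * '[< p.2, q.2 >].

(** Schur's theorem on products of positive kernels, by induction on the
    length. Let [q] be the second component of the head. Writing every second component as a multiple
    of [q] plus a vector orthogonal to [q] splits the sum into
    [phi (w, w) * <q, q>] for one vector [w], and a sum of the same form in
    which the head contributes nothing, as its second component has become
    zero. *)
Lemma schur_ge0 H K (phi : H -> H -> R[i]) (s : seq (H * K)) :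
    (forall a x y z, phi (a *: x + y) z = a * phi x z + phi y z) ->
    (forall a x y z, phi z (a *: x + y) = a^* * phi z x + phi z y) ->
    (forall x, 0 <= phi x x) ->
  0 <= \sum_(p <- s) \sum_(q <- s) phi p.1 q.1 * '[< p.2, q.2 >].
Proof.
move=> phil phir phi_ge0.
have phi0l z : phi 0 z = 0.
  by have := phil 1 0 0 z; rewrite scaler0 addr0 mul1r -[LHS]addr0 => /addrI.
have phi0r z : phi z 0 = 0.
  by have := phir 1 0 0 z; rewrite scaler0 addr0 conjC1 mul1r -[LHS]addr0 => /addrI.
elim: {s}(size s) {-2}s (erefl (size s)) => [|n IH] [|[x q] s] //= sn.
  by rewrite big_nil.
have {sn} sn : size s = n by case: sn.
pose c (r : H * K) := '[< r.2, q >] / '[< q, q >].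
pose d (r : H * K) := r.2 - c r *: q.
have dq r : '[< d r, q >] = 0.
  rewrite /d /c hdotBl hdotZl; have [->|q0] := eqVneq q 0.
    by rewrite !hdot0r mulr0 subrr.
  by rewrite divfK ?subrr// dnorm_eq0.
have d_head : d (x, q) = 0.
  rewrite /d /c /=; have [->|q0] := eqVneq q 0; first by rewrite scaler0 subrr.
  by rewrite divff ?dnorm_eq0// scale1r subrr.
have dotE r t :
    '[< r.2, t.2 >] = c r * (c t)^* * '[< q, q >] + '[< d r, d t >].
  have E (p : H * K) : p.2 = c p *: q + d p by rewrite addrC subrK.
  rewrite {1}(E r) {1}(E t); clearbody c d; rewrite hdotDl !hdotDr !hdotZl !hdotZr dq.
  by rewrite (hdotC q (d t)) dq conjC0; ring.
set l := (x, q) :: s.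
pose w := \sum_(r <- l) c r *: r.1.
have phil_sum (t : seq (H * K)) z :
    phi (\sum_(r <- t) c r *: r.1) z = \sum_(r <- t) c r * phi r.1 z.
  elim: t => [|r t IHt]; first by rewrite !big_nil.
  by rewrite !big_cons phil IHt.
have phir_sum (t : seq (H * K)) z :
    phi z (\sum_(r <- t) c r *: r.1) = \sum_(r <- t) (c r)^* * phi z r.1.
  elim: t => [|r t IHt]; first by rewrite !big_nil.
  by rewrite !big_cons phir IHt.
have -> : \sum_(r <- l) \sum_(t <- l) phi r.1 t.1 * '[< r.2, t.2 >] =
    phi w w * '[< q, q >] +
    \sum_(r <- l) \sum_(t <- l) phi r.1 t.1 * '[< d r, d t >].
  rewrite /w phil_sum mulr_suml -big_split; apply: eq_bigr => r _ /=.
  rewrite phir_sum mulr_sumr mulr_suml -big_split; apply: eq_bigr => t _ /=.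
  by rewrite dotE; ring.
apply: addr_ge0; first by rewrite mulr_ge0 // dnorm_ge0.
rewrite /l big_cons big1 => [|t _]; last by rewrite d_head hdot0l mulr0.
rewrite add0r.
under eq_bigr do rewrite big_cons d_head hdot0r mulr0 add0r.
have := IH [seq (r.1, d r) | r <- s]; rewrite size_map => /(_ sn).
by rewrite big_map; under eq_bigr do rewrite big_map.
Qed.

(** [M ^ 2 <x, y> - <f x, f y>] is a positive kernel. *)
Lemma gram_mapl H H' K (f : H -> H') (M : R) (s : seq (H * K)) :
    linear f -> (forall x, nrm (f x) <= M * nrm x) ->
  gram [seq (f p.1, p.2) | p <- s] <= (M ^+ 2)%:C%C * gram s.
Proof.
move=> fL fM; rewrite /gram -subr_ge0.
pose phi (x y : H) := (M ^+ 2)%:C%C * '[< x, y >] - '[< f x, f y >].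
suff : 0 <= \sum_(p <- s) \sum_(q <- s) phi p.1 q.1 * '[< p.2, q.2 >].
  congr (0 <= _); rewrite mulr_sumr big_map -sumrB; apply: eq_bigr => p _.
  rewrite mulr_sumr big_map -sumrB; apply: eq_bigr => q _.
  by rewrite mulrBl mulrA.
apply: schur_ge0 => [a x y z|a x y z|x]; rewrite /phi.
- by rewrite fL !hdotDl !hdotZl; ring.
- by rewrite fL !hdotDr !hdotZr; ring.
- rewrite !nrm_dot -rmorphM subr_ge0 lecR -exprMn.
  rewrite ler_pXn2r ?nnegrE ?nrm_ge0 //; exact: le_trans (nrm_ge0 (f x)) (fM x).
Qed.

Lemma gram_swap H K (s : seq (H * K)) :
  gram [seq (p.2, p.1) | p <- s] = gram s.
Proof.
rewrite /gram big_map; apply: eq_bigr => p _; rewrite big_map.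
by apply: eq_bigr => q _; rewrite mulrC.
Qed.

(** The factors are mapped one at a time, exchanging them in between, so that
    no intermediate tensor product is needed. *)
Lemma gram_map H H' K K' (f : H -> H') (g : K -> K') (M N : R)
    (s : seq (H * K)) :
    linear f -> (forall x, nrm (f x) <= M * nrm x) ->
    linear g -> (forall x, nrm (g x) <= N * nrm x) ->
  gram [seq (f p.1, g p.2) | p <- s] <= ((M * N) ^+ 2)%:C%C * gram s.
Proof.
move=> fL fM gL gN.
have -> : [seq (f p.1, g p.2) | p <- s] =
    [seq (f p.1, p.2) | p <- [seq (p.2, p.1) |
      p <- [seq (g p.1, p.2) | p <- [seq (p.2, p.1) | p <- s]]]].
  by rewrite -!map_comp.
apply: le_trans (gram_mapl _ fL fM) _; rewrite gram_swap.
have -> : ((M * N) ^+ 2)%:C%C * gram s =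
    (M ^+ 2)%:C%C * ((N ^+ 2)%:C%C * gram s) by rewrite mulrA -rmorphM exprMn.
apply: ler_wpM2l; first by rewrite ler0c sqr_ge0.
by apply: le_trans (gram_mapl _ gL gN) _; rewrite gram_swap.
Qed.

End GramKernel.

(** * Hilbert tensor products *)

Section TensorProducts.
Context {R : realType}.
Implicit Types H K L : hilbertType R.

Lemma nrm_pure H K (T : htensor H K) x y : nrm (pure T x y) = nrm x * nrm y.
Proof.
apply/eqP; rewrite -(@eqrXn2 _ 2) ?mulr_ge0 ?nrm_ge0//; apply/eqP/(@complexI R).
by rewrite -nrm_dot pure_dot !nrm_dot -rmorphM exprMn.
Qed.

Lemma bounded_linear_purel H K (T : htensor H K) y :
  bounded_linear (fun x => pure T x y).
Proof.
apply: (nrm_bounded_linear (M := nrm y)) => [a x x'|x].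
  by rewrite linearPl.
by rewrite nrm_pure mulrC.
Qed.

Lemma bounded_linear_purer H K (T : htensor H K) x :
  bounded_linear (fun y => pure T x y).
Proof.
apply: (nrm_bounded_linear (M := nrm x)) => [a y y'|y].
  by rewrite linearPr.
by rewrite nrm_pure.
Qed.

(** If [z] is orthogonal to the elementary tensors then no finite sum [t] of
    them is closer to [z] than [0], as [|z - t| ^ 2 = |z| ^ 2 + |t| ^ 2]; but
    these sums are dense. *)
Lemma pure_total H K (T : htensor H K) :
  total_family (fun p : H * K => pure T p.1 p.2).
Proof.
move=> z zp; apply/nrm_eq0/ler_addgt0Pr => e e0; rewrite add0r.
have := @pure_dense _ _ _ T (ball z e%:C%C).
case=> [||t [zt [s tE]]].
- by exists z; apply: ballxx; rewrite ltcE /= eqxx.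
- exact: ball_open.
move: zt; rewrite -ball_normE /= nrmE ltcR => /ltW; apply: le_trans.
rewrite -(@ler_pXn2r _ 2) ?nnegrE ?nrm_ge0//.
rewrite -lecR -!nrm_dot dnormB /=.
have tz : '[< t, z >] = 0.
  by rewrite tE hdot_suml big1 // => p _; exact: zp.
by rewrite (hdotC z t) tz !conjC0 addr0 subr0 lerDl dnorm_ge0.
Qed.

(** For fixed [l], the adjoint of [w |-> w (x) l] sends [z] to a vector
    orthogonal to the elementary tensors [x (x) y], hence to zero. *)
Lemma pure_purel_total H K L (HK : htensor H K) (HK_L : htensor HK L) :
  total_family (fun p : H * K * L => pure HK_L (pure HK p.1.1 p.1.2) p.2).
Proof.
move=> z zp; apply: pure_total => -[w l] /=.
have [_ /(_ _ z) pa] := adjointP (bounded_linear_purel HK_L l).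
rewrite pa (_ : adjoint _ z = 0) ?hdot0r//; apply: pure_total => -[x y] /=.
by rewrite -pa (zp (x, y, l)).
Qed.

Lemma pure_purer_total H K L (KL : htensor K L) (H_KL : htensor H KL) :
  total_family (fun p : H * K * L => pure H_KL p.1.1 (pure KL p.1.2 p.2)).
Proof.
move=> z zp; apply: pure_total => -[x w] /=.
have [_ /(_ _ z) pa] := adjointP (bounded_linear_purer H_KL x).
rewrite pa (_ : adjoint _ z = 0) ?hdot0r//; apply: pure_total => -[y l] /=.
by rewrite -pa (zp (x, y, l)).
Qed.

Lemma pure_lincomb H K (T : htensor H K) (s : seq (R[i] * (H * K))) :
  \sum_(p <- s) p.1 *: pure T p.2.1 p.2.2 =
  \sum_(p <- [seq (p.1 *: p.2.1, p.2.2) | p <- s]) pure T p.1 p.2.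
Proof.
by rewrite big_map; apply: eq_bigr => p _; rewrite /= linearZl_LR.
Qed.

Lemma nrm_sum_pure H K (T : htensor H K) (s : seq (H * K)) :
  (nrm (\sum_(p <- s) pure T p.1 p.2) ^+ 2)%:C%C = gram s.
Proof.
rewrite -nrm_dot hdot_suml; apply: eq_bigr => p _.
by rewrite hdot_sumr; apply: eq_bigr => q _; rewrite pure_dot.
Qed.

Lemma tensor_mapP H K H' K' (T : htensor H K) (T' : htensor H' K')
    (f : H -> H') (g : K -> K') : bounded_linear f -> bounded_linear g ->
  bounded_linear (tensor_map T T' f g) /\
  forall x y, tensor_map T T' f g (pure T x y) = pure T' (f x) (g y).
Proof.
move=> fb gb; have [M M0 fM] := bounded_linear_nrm fb.
have [N N0 gN] := bounded_linear_nrm gb; have [fL _] := fb; have [gL _] := gb.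
have [|s|h hb hE] := bounded_extension (M := M * N)
  (v := fun p : H * K => pure T' (f p.1) (g p.2)) _ (@pure_total _ _ T).
- exact: mulr_ge0.
- have -> : \sum_(p <- s) p.1 *: pure T' (f p.2.1) (g p.2.2) =
      \sum_(p <- [seq (f p.1, g p.2) | p <- [seq (p.1 *: p.2.1, p.2.2) | p <- s]])
        pure T' p.1 p.2.
    rewrite !big_map; apply: eq_bigr => p _ /=.
    by rewrite (GRing.scalable_linear fL) linearZl_LR.
  rewrite pure_lincomb; set t := [seq _ | _ <- s].
  have := gram_map t fL fM gL gN; rewrite -(nrm_sum_pure T) -(nrm_sum_pure T').
  by rewrite -rmorphM lecR -exprMn ler_pXn2r // nnegrE ?mulr_ge0 ?nrm_ge0.
apply: (@xgetPex _ (fun=> 0) [set h : T -> T' | bounded_linear h /\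
    forall x y, h (pure T x y) = pure T' (f x) (g y)]).
by exists h; split => // x y; rewrite (hE (x, y)).
Qed.

Lemma associatorP H K L (HK : htensor H K) (KL : htensor K L)
    (HK_L : htensor HK L) (H_KL : htensor H KL) :
  unitary (associator HK KL HK_L H_KL) /\
  forall x y z, associator HK KL HK_L H_KL (pure HK_L (pure HK x y) z) =
    pure H_KL x (pure KL y z).
Proof.
have [[[x y] l] [[x' y'] l']|h hu hE] := total_unitary
  (@pure_purel_total _ _ _ HK HK_L) (@pure_purer_total _ _ _ KL H_KL).
  by rewrite !pure_dot /= mulrA.
apply: (@xgetPex _ (fun=> 0) [set a : HK_L -> H_KL | unitary a /\
    forall x y z, a (pure HK_L (pure HK x y) z) = pure H_KL x (pure KL y z)]).
by exists h; split => // x y z; rewrite (hE (x, y, z)).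
Qed.

Lemma unitary_bounded_linear H K (f : H -> K) : unitary f -> bounded_linear f.
Proof.
case=> fL _ fdot; apply: (nrm_bounded_linear (M := 1)) => // x.
by rewrite mul1r -(@ler_pXn2r _ 2) ?nnegrE ?nrm_ge0// -lecR -!nrm_dot fdot.
Qed.

Lemma unitary_inverse H K (f : H -> K) : unitary f ->
  [/\ bounded_linear (inverse f), cancel f (inverse f) & cancel (inverse f) f].
Proof.
case=> fL [g fg gf] fdot.
have [fK Kf] : cancel f (inverse f) /\ cancel (inverse f) f.
  by apply: (@xgetPex _ (fun=> 0) [set g | cancel f g /\ cancel g f]); exists g.
split=> //; apply: unitary_bounded_linear; split.
- by move=> a x y; apply: (can_inj fK); rewrite fL !Kf.
- by exists f.
- by move=> x y; rewrite -fdot !Kf.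
Qed.

End TensorProducts.

(** * The Frobenius equations on elementary tensors *)

Section FrobeniusPointwise.
Context {R : realType} {H : hilbertType R} {HH : htensor H H}.
Context {HH_H : htensor HH H} {H_HH : htensor H HH}.
Variable mu : HH -> H.
Hypothesis mu_alg : hilbertian_algebra mu.

Local Notation "x ** y" := (hmul mu x y) (at level 40, left associativity).
Local Notation alpha := (associator HH HH HH_H H_HH).
Local Notation L' y := (adjoint (hmul mu y)).

Let mu_bounded : bounded_linear mu. Proof. by case: mu_alg. Qed.

Lemma hmulA : associative (hmul mu). Proof. by case: mu_alg. Qed.

Lemma hmulC : commutative (hmul mu). Proof. by case: mu_alg. Qed.

Lemma bounded_linear_hmul x : bounded_linear (hmul mu x).
Proof. exact: bounded_linear_comp mu_bounded (bounded_linear_purer HH x). Qed.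

Lemma hmul_adjointE y w w' : '[< y ** w, w' >] = '[< w, L' y w' >].
Proof. by have [_] := adjointP (bounded_linear_hmul y); apply. Qed.

Lemma adjoint_swapE w z : '[< adjoint mu w, z >] = '[< w, mu z >].
Proof.
by have [_ E] := adjointP mu_bounded; rewrite hdotC -E -hdotC.
Qed.

Lemma comul_mul_dot x y a b :
  '[< (adjoint mu \o mu) (pure HH x y), pure HH a b >] = '[< x ** y, a ** b >].
Proof. exact: adjoint_swapE. Qed.

(** The adjoint of a map [f (x) g] is given on elementary tensors by the
    adjoints of [f] and [g]. *)
Lemma dot_pure_map (f g f' g' : H -> H) (S : HH -> HH) z a b :
    bounded_linear S ->
    (forall x y, S (pure HH x y) = pure HH (f x) (g y)) ->
    (forall x y, '[< f x, y >] = '[< x, f' y >]) ->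
    (forall x y, '[< g x, y >] = '[< x, g' y >]) ->
  '[< S z, pure HH a b >] = '[< z, pure HH (f' a) (g' b) >].
Proof.
move=> Sb SE ff gg; have [_ E] := adjointP Sb; rewrite E.
congr (hdot _ _); apply: (total_dot_inj (@pure_total _ _ _ HH)) => -[x y] /=.
by rewrite -E SE !pure_dot ff gg.
Qed.

Lemma bounded_linear_pure_eq (F G : HH -> HH) :
    bounded_linear F -> bounded_linear G ->
    (forall x y a b, '[< F (pure HH x y), pure HH a b >] =
       '[< G (pure HH x y), pure HH a b >]) ->
  F = G.
Proof.
move=> Fb Gb FG; apply: (total_bounded_linear_eq (@pure_total _ _ _ HH)) => //.
move=> [x y]; apply: (total_dot_inj (@pure_total _ _ _ HH)) => -[a b] /=.
by rewrite hdotC FG -hdotC.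
Qed.

Let comul_mul_bounded : bounded_linear (adjoint mu \o mu).
Proof. by apply: bounded_linear_comp => //; case: (adjointP mu_bounded). Qed.

Let comul_bounded : bounded_linear (adjoint mu).
Proof. by case: (adjointP mu_bounded). Qed.

(** For fixed [y], the maps [z |-> alpha (z (x) y)] and [id (x) mu] compose to
    [id (x) L_y] by commutativity, whose adjoint is [id (x) L_y^+]; what is
    left of the comultiplication is evaluated by moving it across the inner
    product. *)
Lemma frobenius_right_dot x y a b :
  '[< (tensor_map H_HH HH idfun mu \o alpha \o
        tensor_map HH HH_H (adjoint mu) idfun) (pure HH x y), pure HH a b >]
  = '[< x, a ** L' y b >].
Proof.
have [_ tE] := tensor_mapP HH HH_H comul_bounded (bounded_linear_id H).
have [sb sE] := tensor_mapP H_HH HH (bounded_linear_id H) mu_bounded.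
have [au aE] := associatorP HH_H H_HH.
rewrite /= tE /=.
rewrite (@dot_pure_map idfun (hmul mu y) idfun (L' y)
  ((tensor_map H_HH HH idfun mu \o alpha) \o (fun z => pure HH_H z y))) //.
- exact: adjoint_swapE.
- apply: bounded_linear_comp (bounded_linear_purel HH_H y).
  exact: bounded_linear_comp sb (unitary_bounded_linear au).
- by move=> p q /=; rewrite aE sE hmulC.
- exact: hmul_adjointE.
Qed.

(** Here [z |-> (mu (x) id) (alpha^-1 (x (x) z))] is [L_x (x) id]. *)
Lemma frobenius_left_dot x y a b :
  '[< (tensor_map HH_H HH mu idfun \o inverse alpha \o
        tensor_map HH H_HH idfun (adjoint mu)) (pure HH x y), pure HH a b >]
  = '[< y, L' x a ** b >].
Proof.
have [_ tE] := tensor_mapP HH H_HH (bounded_linear_id H) comul_bounded.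
have [sb sE] := tensor_mapP HH_H HH mu_bounded (bounded_linear_id H).
have [au aE] := associatorP HH_H H_HH.
have [ib aK _] := unitary_inverse au.
rewrite /= tE /=.
rewrite (@dot_pure_map (hmul mu x) idfun (L' x) idfun
  ((tensor_map HH_H HH mu idfun \o inverse alpha) \o (fun z => pure H_HH x z))) //.
- exact: adjoint_swapE.
- apply: bounded_linear_comp (bounded_linear_purer H_HH x).
  exact: bounded_linear_comp sb ib.
- by move=> p q /=; rewrite -aE aK sE.
- exact: hmul_adjointE.
Qed.

(** Both sides of each Frobenius equation are bounded, so that it is enough to
    compare their matrix coefficients between elementary tensors. *)
Lemma frobenius_pointwise :
  hilbertian_frobenius_semigroup HH_H H_HH mu <->
  forall x y a b, '[< x ** y, a ** b >] = '[< x, a ** L' y b >] /\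
    '[< x ** y, a ** b >] = '[< y, L' x a ** b >].
Proof.
have [tb _] := tensor_mapP HH HH_H comul_bounded (bounded_linear_id H).
have [sb _] := tensor_mapP H_HH HH (bounded_linear_id H) mu_bounded.
have [tb' _] := tensor_mapP HH H_HH (bounded_linear_id H) comul_bounded.
have [sb' _] := tensor_mapP HH_H HH mu_bounded (bounded_linear_id H).
have [au _] := associatorP HH_H H_HH.
have [ib _ _] := unitary_inverse au.
split=> [[_ FL FR] x y a b|F].
  by rewrite -frobenius_right_dot -frobenius_left_dot -comul_mul_dot FL FR.
split=> //; apply: bounded_linear_pure_eq => //.
- exact: bounded_linear_comp (bounded_linear_comp sb' ib) tb'.
- move=> x y a b; rewrite frobenius_left_dot comul_mul_dot.
  by have [_ <-] := F x y a b.
- exact: bounded_linear_comp (bounded_linear_comp sb (unitary_bounded_linear au)) tb.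
- move=> x y a b; rewrite frobenius_right_dot comul_mul_dot.
  by have [<- _] := F x y a b.
Qed.

End FrobeniusPointwise.

(** * Existence of adjoint elements *)

Section HstarOfFrobenius.
Context {R : realType} {H : hilbertType R} {HH : htensor H H}.
Variable mu : HH -> H.
Hypothesis mu_alg : hilbertian_algebra mu.

Local Notation "x ** y" := (hmul mu x y) (at level 40, left associativity).
Local Notation L' y := (adjoint (hmul mu y)).
Local Notation Hstar := (Hstar_adjoint mu).

Hypothesis L'M : forall y a b, L' y (a ** b) = a ** L' y b.

Let mulA := hmulA mu_alg.
Let mulC := hmulC mu_alg.
Let mulL x : linear (hmul mu x) := (bounded_linear_hmul mu_alg x).1.
Let mulE := hmul_adjointE mu_alg.

Let mulEr y w v : '[< L' y w, v >] = '[< w, y ** v >].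
Proof. by rewrite hdotC -mulE -hdotC. Qed.

Let mul0 x : x ** 0 = 0.
Proof. by apply: hdot_inj => w; rewrite -mulEr !hdot0r. Qed.

Lemma Hstar_sym u v : Hstar u v -> Hstar v u.
Proof. by move=> uv w w'; rewrite hdotC -uv -hdotC. Qed.

(** [L_c = L_y^+ L_b] for [c = L_y^+ b], so that
    [L_c^+ = L_b^+ L_y = L_d] for [d = L_b^+ y]. *)
Lemma Hstar_adjoint_hmul y b : Hstar (L' y b) (L' b y).
Proof.
move=> w w'; rewrite mulC -L'M mulEr.
by rewrite [L' b y ** w']mulC -L'M -mulE mulC [w' ** y]mulC.
Qed.

(** If [a] is annihilated by every element then so is [L_z^+ a], whence
    [<L_z^+ a, L_z^+ a> = <z (L_z^+ a), a> = 0]. *)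
Lemma annihilator_adjoint a z : (forall w, w ** a = 0) -> L' z a = 0.
Proof.
move=> a0; apply: hdot_eq0; rewrite -mulE -L'M a0.
suff -> : L' z 0 = 0 by rewrite hdot0l.
by apply: hdot_inj => w; rewrite -mulE !hdot0r.
Qed.

(** Taking [p = L_b^+ y] and [q = L_z^+ w], whose adjoint elements are known,
    [<p q, x> = <w, z (L_y^+ b) x>]; hence [z (L_y^+ b) x = 0]. Therefore
    [<b z x, b z x> = <z x, L_b^+ (b z x)> = <z x, z (L_b^+ b) x> = 0], so that
    [z x] is annihilated by every [b], and
    [<z x, z x> = <x, L_z^+ (z x)> = 0]. *)
Lemma orthogonal_products_annihilator x :
    (forall p p' q q', Hstar p p' -> Hstar q q' -> '[< p ** q, x >] = 0) ->
  forall w, w ** x = 0.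
Proof.
move=> px0.
have L'x y b z : z ** (L' y b ** x) = 0.
  apply: hdot_inj => w; rewrite hdot0r -mulEr -(Hstar_adjoint_hmul b y).
  exact: px0 (Hstar_adjoint_hmul b y) (Hstar_adjoint_hmul z w).
have mulmulx b z : b ** (z ** x) = 0.
  apply: hdot_eq0; rewrite mulE [b ** (z ** x)]mulC L'M.
  by rewrite [_ ** L' b b]mulC mulA [L' b b ** z]mulC -mulA L'x hdot0r.
by move=> z; apply: hdot_eq0; rewrite mulE annihilator_adjoint ?hdot0r.
Qed.

(** Pairs of mutually [H^*]-adjoint elements which behave as products
    of elements having [H^*]-adjoints do. The point of the second condition is
    that it makes the passage to the adjoint isometric, and that it survives
    limits. *)
Definition star_graph : set (H * H) := [set c | Hstar c.1 c.2 /\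
  forall r r', Hstar r r' -> '[< c.1, r >] = '[< r', c.2 >]].

(** Apply the second condition to the pair itself. *)
Lemma star_graph_nrm c : star_graph c -> nrm c.2 = nrm c.1.
Proof.
move=> [cc cr]; apply/eqP; rewrite -(@eqrXn2 _ 2) ?nrm_ge0//.
apply/eqP/(@complexI R).
by rewrite -!nrm_dot (cr _ _ cc).
Qed.

Lemma star_graph_mul p p' q q' :
  Hstar p p' -> Hstar q q' -> star_graph (p ** q, p' ** q').
Proof.
move=> pp qq; split=> [w w'|r r' rr] /=.
  by rewrite -mulA pp qq mulA [q' ** p']mulC.
by rewrite -pp [p ** r']mulC (Hstar_sym rr) [r ** q']mulC -qq mulC.
Qed.

Lemma star_graph_lin a c d : star_graph c -> star_graph d ->
  star_graph (a *: c.1 + d.1, a^* *: c.2 + d.2).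
Proof.
move=> [cc cr] [dd dr]; split=> [w w'|r r' rr] /=.
  rewrite [_ ** w]mulC [_ ** w']mulC !mulL hdotDl hdotDr hdotZl hdotZr conjCK.
  by rewrite ![w ** _]mulC ![w' ** _]mulC cc dd.
by rewrite hdotDl hdotDr hdotZl hdotZr conjCK (cr _ _ rr) (dr _ _ rr).
Qed.

Lemma star_graph_closed : closed star_graph.
Proof.
move=> [c c'] Gc.
have lim s t : (forall d, star_graph d -> '[< d.1, s >] = '[< t, d.2 >]) ->
    '[< c, s >] = '[< t, c' >].
  by move=> st; exact: (closed_dot_eq (closureS st Gc)).
split=> [w w'|r r' rr] /=; last by apply: lim => d [_]; apply.
rewrite [c ** w]mulC mulE [c' ** w']mulC -mulEr; apply: lim => d [dd _].
by rewrite -mulE [w ** _]mulC dd mulEr [w' ** _]mulC.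
Qed.

Theorem Hstar_of_adjoint_module u : exists v, Hstar u v.
Proof.
pose P : set H := [set c | exists c', star_graph (c, c')].
have P0 : P 0.
  exists 0; split=> [w w'|r r' _] /=; last by rewrite hdot0l hdot0r.
  by rewrite ![0 ** _]mulC !mul0 hdot0l hdot0r.
have PP a c d : P c -> P d -> P (a *: c + d).
  move=> [c' cc] [d' dd]; exists (a^* *: c' + d').
  exact: (star_graph_lin a cc dd).
have Pcl : closed P.
  move=> c Pc.
  have [|||c' cc] := @bounded_relation_closure R H H star_graph 1 c.
  - move=> p q Gp Gq; have := star_graph_lin (-1) Gq Gp.
    by rewrite rmorphN1 !scaleN1r !(addrC (- _)).
  - by move=> p /star_graph_nrm ->; rewrite mul1r.
  - apply: (closureS _ Pc) => d [d' dd]; by exists (d, d').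
  - by exists c'; apply: star_graph_closed.
have [c [c' [/= cc _]] uc] := orthogonal_projection u P0 PP Pcl.
have ann w : w ** (u - c) = 0.
  apply: orthogonal_products_annihilator => p p' q q' pp qq.
  by apply: uc; exists (p' ** q'); apply: star_graph_mul.
exists c' => w w'; rewrite -cc; congr (hdot _ _).
apply/subr0_eq; rewrite ![_ ** w]mulC -[RHS](ann w) addrC -scaleN1r -mulL.
by rewrite scaleN1r addrC.
Qed.

End HstarOfFrobenius.

(** * Hilbertian H-star algebras and Frobenius semigroups *)

Theorem proposition39 (R : realType) (H : hilbertType R) (HH : htensor H H)
    (HH_H : htensor HH H) (H_HH : htensor H HH) (mu : HH -> H)
    (mu_alg : hilbertian_algebra mu) :
  hilbertian_Hstar_algebra mu <->
  hilbertian_frobenius_semigroup HH_H H_HH mu.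
Proof.
have mulA := hmulA mu_alg; have mulC := hmulC mu_alg.
have mulE := hmul_adjointE mu_alg.
rewrite (frobenius_pointwise mu_alg).
split=> [[_ Hstar] x y a b|F].
  have L'E u v w : Hstar_adjoint mu u v -> adjoint (hmul mu u) w = hmul mu v w.
    by move=> uv; apply: hdot_inj => z; rewrite -mulE uv.
  have [u xu] := Hstar x; have [v yv] := Hstar y.
  rewrite (L'E _ _ _ yv) (L'E _ _ _ xu); split.
    by rewrite mulA [hmul mu a v]mulC -mulA -yv [hmul mu y x]mulC.
  by rewrite -mulA -xu.
split=> // u; apply: (Hstar_of_adjoint_module mu_alg) => y a b.
by apply: hdot_inj => w; rewrite -mulE mulC; have [] := F w y a b.
Qed.
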